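(* The classes of groups $\mathsf{CR}_0$, $\mathsf{CWR}_0$ and $\mathsf{CD}_0$ all coincide, and they are equal to the class of all residually finite infinite groups.
   Context: A residual chain $\Lambda_*=(\Lambda_i)_{i\in\mathbb{N}}$ in a group $\Gamma$ is a nested sequence $\Gamma=\Lambda_0\ge\Lambda_1\ge\cdots$ of finite index normal subgroups of $\Gamma$ with $\bigcap_i\Lambda_i=\{1\}$; $\Gamma$ is residually finite if it admits a residual chain. A based free module is a free module with a chosen basis. A based free $\mathbb{Z}$-module carries the $\ell^1$-norm of its basis; $\|f\|$ denotes the operator norm of a map between based free $\mathbb{Z}$-modules. A chain complex ($\mathbb{Z}$-graded) is based free if all its chain modules are. A homotopy retract $(X,X',\xi,\xi',\Xi)$ consists of chain complexes $X,X'$, chain maps $\xi\colon X\to X'$, $\xi'\colon X'\to X$, and a chain homotopy $\Xi_j\colon X_j\to X_{j+1}$ with $\partial\Xi+\Xi\partial=\mathrm{id}_X-\xi'\xi$. Let $n\in\mathbb{Z}$, let $X,X'$ be based free $\mathbb{Z}$-chain complexes with $X_j,X'_j$ finitely generated for $j\le n$, and $T,\kappa\in\mathbb{R}_{\ge1}$. The homotopy retract is an $n$-domination of $X$ of quality $(T,\kappa)$ if $\mathrm{rk}_{\mathbb{Z}}(X'_j)\le\kappa T^{-1}\mathrm{rk}_{\mathbb{Z}}(X_j)$ for all $j\le n$; a weak $n$-rebuilding of quality $(T,\kappa)$ if moreover $\|\partial^{X'}_j\|,\|\xi_j\|\le\exp(\kappa)T^\kappa$ for all $j\le n$; and an $n$-rebuilding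 of quality $(T,\kappa)$ if moreover $\|\xi'_j\|,\|\Xi_j\|\le\exp(\kappa)T^\kappa$ for all $j\le n$. For a $\mathbb{Z}\Gamma$-chain complex $X$ and $\Lambda\le\Gamma$, $X_\Lambda:=\mathbb{Z}\otimes_{\mathbb{Z}\Lambda}X$; if $X$ is based free over $\mathbb{Z}\Gamma$, then $X_\Lambda$ is based free over $\mathbb{Z}$ with the induced basis (the images of $\gamma e$, $\gamma\in\Gamma$, $e$ a basis element). For residually finite $\Gamma$, $\mathsf{CR}^\Gamma_n$ (resp. $\mathsf{CWR}^\Gamma_n$, $\mathsf{CD}^\Gamma_n$) is the class of based free $\mathbb{Z}\Gamma$-chain complexes $X$ with $X_j$ finitely generated over $\mathbb{Z}\Gamma$ for all $j\le n$ such that: there exists $\kappa\ge1$ such that for all $T\ge1$ and all residual chains $\Lambda_*$ in $\Gamma$ there is $i_0\in\mathbb{N}$ such that for all $i\ge i_0$ the complex $X_{\Lambda_i}$ admits an $n$-rebuilding (resp. weak $n$-rebuilding, $n$-domination) of quality $(T,\kappa)$. $\mathsf{CR}_n$ (resp. $\mathsf{CWR}_n$, $\mathsf{CD}_n$) is the class of residually finite groups $\Gamma$ for which the trivial module $\mathbb{Z}$ admits a projective $\mathbb{Z}\Gamma$-resolution lying in $\mathsf{CR}^\Gamma_n$ (resp. $\mathsf{CWR}^\Gamma_n$, $\mathsf{CD}^\Gamma_n$). *)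

(* Defs.v *)
From HB Require Import structures.
From mathcomp Require Import all_boot all_order all_algebra finmap.
From mathcomp.multinomials Require Import monalg.
From mathcomp Require Import boolp classical_sets functions cardinality.
From mathcomp Require Import reals ereal sequences exp.

Set Implicit Arguments.
Unset Strict Implicit.
Unset Printing Implicit Defensive.

Import Order.TTheory GRing.Theory Num.Theory.

Local Open Scope classical_set_scope.
Local Open Scope ring_scope.

Section LinComb.
Variables (R : nzRingType) (I : choiceType) (V : lmodType R).

(* {malg R[I]} is used as the type of finitely supported functions I -> R. *)
Definition lincomb (e : I -> V) (c : {malg R[I]}) : V :=
  \sum_(i <- msupp c) c@_i *: e i.

Lemma lincombw (e : I -> V) (c : {malg R[I]}) (d : {fset I}) :
  (msupp c `<=` d)%fset -> lincomb e c = \sum_(i <- d) c@_i *: e i.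
Proof.
move=> led; apply: big_fset_incl => // i _ /mcoeff_outdom ->.
by rewrite scale0r.
Qed.

Lemma lincomb_is_linear (e : I -> V) : linear (lincomb e).
Proof.
move=> a c c'; pose d := (msupp c `|` msupp c')%fset.
have ic : (msupp c `<=` d)%fset by exact: fsubsetUl.
have ic' : (msupp c' `<=` d)%fset by exact: fsubsetUr.
have isum : (msupp (a *: c + c') `<=` d)%fset.
  apply: fsubset_trans (msuppD_le _ _) _.
  by rewrite fsubUset ic' (fsubset_trans (msuppZ_le _ _) ic).
rewrite (lincombw e ic) (lincombw e ic') (lincombw e isum).
rewrite scaler_sumr -big_split /=; apply: eq_bigr => i _.
by rewrite mcoeffD mcoeffZ scalerDl scalerA.
Qed.

HB.instance Definition _ (e : I -> V) :=
  GRing.isLinear.Build R {malg R[I]} V _ (lincomb e) (lincomb_is_linear e).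

Lemma lincombU (e : I -> V) (a : R) (i : I) :
  lincomb e << a *g i >> = a *: e i.
Proof. by rewrite (lincombw e msuppU_le) big_seq_fset1 mcoeffUU. Qed.

Lemma malg_ind (P : {malg R[I]} -> Prop) :
  P 0 -> (forall a i c, P c -> P (<< a *g i >> + c)) -> forall c, P c.
Proof.
move=> P0 PD c; rewrite [c]monalgE; elim: (msupp c : seq I) => [|i s IH].
  by rewrite big_nil.
by rewrite big_cons; apply: PD.
Qed.

Definition is_basis (e : I -> V) : Prop :=
  forall x : V, exists! c : {malg R[I]}, x = lincomb e c.

End LinComb.

Section Complexes.
Variable R : nzRingType.

Record based (M : lmodType R) := Based {
  bidx : choiceType;
  bvec :> bidx -> M;
  bvecP : is_basis bvec }.

Definition coord (M : lmodType R) (B : based M) (x : M) : {malg R[bidx B]} :=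
  projT1 (cid (bvecP B x)).

Definition finitely_generated (M : lmodType R) : Prop :=
  exists s : seq M, forall x : M,
    exists c : 'I_(size s) -> R, x = \sum_(i < size s) c i *: s`_i.

Definition projective (P : lmodType R) : Prop :=
  forall (M N : lmodType R) (f : {linear M -> N}) (g : {linear P -> N}),
    (forall y, exists x, f x = y) ->
    exists h : {linear P -> M}, forall x, f (h x) = g x.

(* The differential [diff j] goes from degree 1 + j to degree j: j ranges over
   all integers, so this covers every degree, and no cast between degrees
   j + 1 - 1 and j is needed. *)
Record chain_complex := ChainComplex {
  chmod :> int -> lmodType R;
  diff : forall j : int, {linear chmod (1 + j) -> chmod j};
  diffK : forall (j : int) (x : chmod (1 + (1 + j))), diff j (diff (1 + j) x) = 0 }.

Record based_complex := BasedComplex {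
  bcpx :> chain_complex;
  bbase : forall j : int, based (bcpx j) }.

Record chain_map (X Y : chain_complex) := ChainMap {
  chmap :> forall j : int, {linear X j -> Y j};
  chmapP : forall (j : int) (x : X (1 + j)),
    chmap j (diff X j x) = diff Y j (chmap (1 + j) x) }.

Record homotopy_retract (X X' : chain_complex) := HomotopyRetract {
  hr_xi : chain_map X X';
  hr_xi' : chain_map X' X;
  hr_Xi : forall j : int, {linear X j -> X (1 + j)};
  hr_htpyP : forall (j : int) (x : X (1 + j)),
    diff X (1 + j) (hr_Xi (1 + j) x) + hr_Xi j (diff X j x)
      = x - hr_xi' (1 + j) (hr_xi (1 + j) x) }.

Definition projective_resolution (M : lmodType R) (X : chain_complex) : Prop :=
  [/\ forall j : int, projective (X j),
      forall (j : int) (x : X j), j < 0 -> x = 0,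
      forall (j : int) (x : X (1 + j)), 0 <= j -> diff X j x = 0 ->
        exists y, x = diff X (1 + j) y &
      exists aug : {linear X 0 -> M},
        (forall m, exists x, aug x = m) /\
        (forall x : X 0, aug x = 0 <-> exists y, x = diff X 0 y)].

End Complexes.

Section Tensor.
Variables (A : nzRingType) (S : {pred A}) (M : lmodType A^c) (N : lmodType A).

Inductive tensor_rel : {malg int[(M * N)%type]} -> Prop :=
| TensorDl m m' n :
    tensor_rel (<< (m + m', n) >> - << (m, n) >> - << (m', n) >>)
| TensorDr m n n' :
    tensor_rel (<< (m, n + n') >> - << (m, n) >> - << (m, n') >>)
| TensorZ s m n : s \in S ->
    tensor_rel (<< ((s : A^c) *: m, n) >> - << (m, s *: n) >>).

Definition tensor_ker : {pred {malg int[(M * N)%type]}} := fun z =>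
  `[< forall H : zmodClosed {malg int[(M * N)%type]},
        (forall r, tensor_rel r -> r \in H) -> z \in H >].

Lemma tensor_ker_zmod : zmod_closed tensor_ker.
Proof.
split=> [|x y /asboolP hx /asboolP hy]; apply/asboolP => H hH.
  exact: rpred0.
by apply: rpredB; [apply: hx | apply: hy].
Qed.

HB.instance Definition _ := GRing.isZmodClosed.Build
  {malg int[(M * N)%type]} tensor_ker tensor_ker_zmod.

(* The tensor product over a subring S of A of a right A-module M (a left
   module over the converse ring of A) and a left A-module N. *)
Definition tensor : zmodType := Quotient.quot tensor_ker.

Definition tens (m : M) (n : N) : tensor :=
  (\pi_(Quotient.quot tensor_ker) << (m, n) >>)%qT.

(* Meaningful for S-balanced t only, see tlift_tens. *)
Definition tlift (B : zmodType) (t : M -> N -> B) (z : tensor) : B :=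
  lincomb (fun p : M * N => t p.1 p.2 : zmodule B)
    (repr (z : Quotient.quot tensor_ker)).

Lemma tensor_eq0 (z : {malg int[(M * N)%type]}) : z \in tensor_ker ->
  (\pi_(Quotient.quot tensor_ker) z)%qT = 0.
Proof.
move=> zK; rewrite -[RHS](raddf0 (\pi_(Quotient.quot tensor_ker))%qT).
by apply/eqP; rewrite -Quotient.idealrBE subr0.
Qed.

Lemma tensor_rel_ker z : tensor_rel z -> z \in tensor_ker.
Proof. by move=> hz; apply/asboolP => H hH; apply: hH. Qed.

Lemma tensDl m m' n : tens (m + m') n = tens m n + tens m' n.
Proof.
apply/eqP; rewrite -subr_eq0 opprD addrA; apply/eqP.
rewrite /tens -!raddfB /=.
by apply/tensor_eq0/tensor_rel_ker/TensorDl.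
Qed.

Lemma tensDr m n n' : tens m (n + n') = tens m n + tens m n'.
Proof.
apply/eqP; rewrite -subr_eq0 opprD addrA; apply/eqP.
rewrite /tens -!raddfB /=.
by apply/tensor_eq0/tensor_rel_ker/TensorDr.
Qed.

Lemma tensZ s m n : s \in S -> tens ((s : A^c) *: m) n = tens m (s *: n).
Proof.
move=> sS; apply/eqP; rewrite -subr_eq0; apply/eqP.
rewrite /tens -!raddfB /=.
by apply/tensor_eq0/tensor_rel_ker/TensorZ.
Qed.

Lemma tensor_span (P : tensor -> Prop) :
  P 0 -> (forall x y, P x -> P y -> P (x - y)) ->
  (forall m n, P (tens m n)) -> forall z, P z.
Proof.
move=> P0 PB Pt z; rewrite -[z](@reprK _ (Quotient.quot tensor_ker)).
have PN x : P x -> P (- x) by rewrite -sub0r; apply: PB.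
have PD x y : P x -> P y -> P (x + y).
  by move=> Px Py; rewrite -[y]opprK; apply/PB/PN.
elim/malg_ind: (repr z) => [|a [m n] c Pc]; first by rewrite raddf0.
rewrite raddfD; apply: (PD) => //.
have -> : << a *g (m, n) >> = << (m, n) >> *~ a :> {malg int[(M * N)%type]}.
  by rewrite -raddfMz /= intz.
rewrite raddfMz -/(tens m n).
have Pn k : P (tens m n *+ k).
  by elim: k => [|k IH]; rewrite ?mulr0n // mulrS; apply: PD.
by case: a => k; rewrite ?NegzE ?mulrNz; [|apply: PN]; apply: Pn.
Qed.

Definition balanced (B : zmodType) (t : M -> N -> B) : Prop :=
  [/\ forall m m' n, t (m + m') n = t m n + t m' n,
      forall m n n', t m (n + n') = t m n + t m n' &
      forall s m n, s \in S -> t ((s : A^c) *: m) n = t m (s *: n)].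

Section Lift.
Variables (B : zmodType) (t : M -> N -> B) (tP : balanced t).

Let lc := lincomb (fun p : M * N => t p.1 p.2 : zmodule B).

Let lc_ker z : z \in tensor_ker -> lc z = 0.
Proof.
move=> /asboolP zK.
pose H : {pred {malg int[(M * N)%type]}} := fun z => lc z == 0.
have Hc : zmod_closed H.
  split; first by apply/eqP; rewrite /lc raddf0.
  by move=> x y /eqP hx /eqP hy; apply/eqP; rewrite /lc raddfB /= -/lc hx hy subrr.
pose HH : zmodClosed _ := HB.pack H (GRing.isZmodClosed.Build _ H Hc).
apply/eqP/(zK HH) => _ [m m' n|m n n'|s m n sS]; apply/eqP;
  rewrite /lc !raddfB /= !lincombU !scale1r /=; case: tP => tl tr tz.
- by rewrite tl -addrA -opprD subrr.
- by rewrite tr -addrA -opprD subrr.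
- by rewrite tz // subrr.
Qed.

Lemma tlift_pi z : tlift t (\pi_(Quotient.quot tensor_ker) z)%qT = lc z.
Proof.
have h : lc (repr (\pi_(Quotient.quot tensor_ker) z)%qT - z) = 0.
  by apply: lc_ker; rewrite Quotient.idealrBE reprK.
by rewrite /lc raddfB in h; apply: subr0_eq h.
Qed.

Lemma tlift_tens m n : tlift t (tens m n) = t m n.
Proof. by rewrite /tens tlift_pi /lc lincombU scale1r. Qed.

Lemma tlift_is_zmod_morphism : zmod_morphism (tlift t).
Proof.
move=> x y; rewrite -[x](@reprK _ (Quotient.quot tensor_ker)).
rewrite -[y](@reprK _ (Quotient.quot tensor_ker)).
by rewrite -raddfB !tlift_pi /lc raddfB.
Qed.

End Lift.

End Tensor.

Section TensorMap.
Variables (A : nzRingType) (S : {pred A}) (M : lmodType A^c).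

Lemma tmap_balanced (N N' : lmodType A) (f : {linear N -> N'}) :
  balanced S (fun (m : M) n => tens S m (f n)).
Proof.
split=> [m m' n|m n n'|s m n sS].
- exact: tensDl.
- by rewrite raddfD tensDr.
- by rewrite linearZ tensZ.
Qed.

Definition tmap (N N' : lmodType A) (f : {linear N -> N'}) :
    zmodule (tensor S M N) -> zmodule (tensor S M N') :=
  tlift (fun m n => tens S m (f n)).

Variables (N N' : lmodType A) (f : {linear N -> N'}).

Lemma tmap_is_linear : linear (tmap f).
Proof.
pose g := tmap f.
have gB : zmod_morphism g := tlift_is_zmod_morphism (tmap_balanced f).
pose G : {additive _ -> _} := HB.pack g (GRing.isZmodMorphism.Build _ _ g gB).
by move=> a x y; rewrite -/g -[g]/(G : _ -> _) raddfD; congr (_ + _); exact: (raddfMz G).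
Qed.

HB.instance Definition _ := GRing.isLinear.Build int
  (zmodule (tensor S M N)) (zmodule (tensor S M N')) _ (tmap f) tmap_is_linear.

Lemma tmap_tens m n : tmap f (tens S m n) = tens S m (f n).
Proof. exact: (tlift_tens (tmap_balanced f)). Qed.

End TensorMap.

(* Unfolding these makes failing unification problems very slow. *)
#[global] Opaque tens tlift.

Definition group_ring (G : groupType) : Type := {malg int[G]}.

Section GroupRing.
Variable G : groupType.

HB.instance Definition _ := GRing.Lmodule.copy (group_ring G) {malg int[G]}.

Definition gr_one : group_ring G := << 1%g >>.

Definition gr_mul (a b : group_ring G) : group_ring G :=
  lincomb (fun x : G => lincomb (fun y : G => << (x * y)%g >>) b) a.

Lemma gr_mulDl : left_distributive gr_mul +%R.
Proof. by move=> a b c; rewrite /gr_mul raddfD. Qed.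

Lemma gr_mulDr : right_distributive gr_mul +%R.
Proof.
move=> a b c; rewrite /gr_mul /lincomb -big_split /=; apply: eq_bigr => x _.
by rewrite -scalerDr -/(lincomb _ b) -/(lincomb _ c) -raddfD.
Qed.

Lemma gr_ind (P : group_ring G -> Prop) :
  P 0 ->
  (forall (m : int) (x : G) (a : group_ring G),
     P a -> P ((<< m *g x >> : group_ring G) + a)) ->
  forall a, P a.
Proof. exact: malg_ind. Qed.

Lemma gr_mulUU (m n : int) (x y : G) :
  gr_mul << m *g x >> << n *g y >> = << m * n *g (x * y)%g >>.
Proof.
rewrite /gr_mul !lincombU scalerA; apply/malgP => k.
by rewrite mcoeffZ !mcoeffU mulrnAr mulr1.
Qed.

Lemma gr_mul0 a : gr_mul a 0 = 0.
Proof. by apply: (addrI (gr_mul a 0)); rewrite -gr_mulDr !addr0. Qed.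

Lemma gr_0mul a : gr_mul 0 a = 0.
Proof. by apply: (addrI (gr_mul 0 a)); rewrite -gr_mulDl !addr0. Qed.

Lemma gr_mulA : associative gr_mul.
Proof.
have := gr_mulUU; have := gr_mul0; have := gr_0mul.
have := gr_mulDl; have := gr_mulDr.
move: gr_mul => mul mDr mDl m0l m0r mUU a b c.
elim/gr_ind: a => [|m x a IHa]; first by rewrite !m0l.
rewrite mDl IHa (mDl _ a) (mDl _ _ c); congr (_ + _).
clear a IHa.
elim/gr_ind: b => [|n y b IHb]; first by rewrite m0l !m0r m0l.
rewrite (mDl _ b) mDr IHb (mDr _ _ b) (mDl _ _ c); congr (_ + _).
clear b IHb.
elim/gr_ind: c => [|p z c IHc]; first by rewrite !m0r.
by rewrite !(mDr _ _ c) mDr IHc !mUU mulrA mulgA.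
Qed.

Lemma gr_mul1 : left_id gr_one gr_mul.
Proof.
move=> a; elim/gr_ind: a => [|m x a IHa]; first by rewrite gr_mul0.
by rewrite gr_mulDr IHa gr_mulUU mul1r mul1g.
Qed.

Lemma gr_1mul : right_id gr_one gr_mul.
Proof.
move=> a; elim/gr_ind: a => [|m x a IHa]; first by rewrite gr_0mul.
by rewrite gr_mulDl IHa gr_mulUU mulr1 mulg1.
Qed.

Lemma gr_one_neq0 : gr_one != 0.
Proof. by rewrite monalgU_eq0. Qed.

HB.instance Definition _ := GRing.Zmodule_isNzRing.Build (group_ring G)
  gr_mulA gr_mul1 gr_1mul gr_mulDl gr_mulDr gr_one_neq0.

#[global] Opaque gr_mul.

Definition gr_elt (g : G) : group_ring G := << g >>.

Definition augmentation (a : group_ring G) : int := \sum_(g <- msupp a) a@_g.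

Lemma augmentationE a : augmentation a = lincomb (fun=> 1 : int^o) a.
Proof.
by rewrite /augmentation /lincomb; apply: eq_bigr => g _; rewrite /GRing.scale /= mulr1.
Qed.

Lemma augmentationD a b : augmentation (a + b) = augmentation a + augmentation b.
Proof. by rewrite !augmentationE raddfD. Qed.

Lemma augmentationU m g : augmentation << m *g g >> = m.
Proof. by rewrite !augmentationE lincombU /GRing.scale /= mulr1. Qed.

Lemma augmentation1 : augmentation 1 = 1.
Proof. exact: augmentationU. Qed.

Lemma augmentationM (a b : group_ring G) :
  augmentation (a * b) = augmentation a * augmentation b.
Proof.
have e0 : augmentation 0 = 0 by rewrite augmentationE raddf0.
elim/gr_ind: a => [|m x a IHa]; first by rewrite mul0r e0 mul0r.
rewrite mulrDl !augmentationD IHa mulrDl; congr (_ + _).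
clear a IHa.
elim/gr_ind: b => [|n y b IHb]; first by rewrite mulr0 e0 mulr0.
rewrite mulrDr !augmentationD IHb mulrDr; congr (_ + _).
by rewrite -[_ * _]/(gr_mul _ _) gr_mulUU !augmentationU.
Qed.

Definition sub_group_ring (L : groupClosed G) : {pred group_ring G} :=
  fun a => all (mem L) (msupp a).

End GroupRing.

(* Z with the trivial left, resp. right, action. *)
Definition trivZ (G : groupType) : Type := int.
Definition trivZr (G : groupType) : Type := int.

Section Trivial.
Variable G : groupType.
Local Notation ZG := (group_ring G).

HB.instance Definition _ := GRing.Zmodule.copy (trivZ G) int.
HB.instance Definition _ := GRing.Zmodule.copy (trivZr G) int.

Let tscale (a : ZG) (m : int) : int := augmentation a * m.

Let tscaleA a b m : tscale a (tscale b m) = tscale (a * b) m.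
Proof. by rewrite /tscale augmentationM mulrA. Qed.

Let tscaleAr a b m : tscale a (tscale b m) = tscale (b * a) m.
Proof. by rewrite /tscale augmentationM mulrCA mulrA. Qed.

Let tscale1 : left_id 1 tscale.
Proof. by move=> m; rewrite /tscale augmentation1 mul1r. Qed.

Let tscaleDr : right_distributive tscale +%R.
Proof. by move=> a m n; rewrite /tscale mulrDr. Qed.

Let tscaleDl m : {morph tscale^~ m : a b / a + b}.
Proof. by move=> a b; rewrite /tscale augmentationD mulrDl. Qed.

HB.instance Definition _ := GRing.Zmodule_isLmodule.Build ZG (trivZ G)
  tscaleA tscale1 tscaleDr tscaleDl.
HB.instance Definition _ := GRing.Zmodule_isLmodule.Build ZG^c (trivZr G)
  tscaleAr tscale1 tscaleDr tscaleDl.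

End Trivial.

Section Induced.
Variables (G : groupType) (L : groupClosed G).
Local Notation ZG := (group_ring G).

Definition induced_mod (X : lmodType ZG) : lmodType int :=
  zmodule (tensor (sub_group_ring L) (trivZr G) X).

Definition induced_elt (X : lmodType ZG) (x : X) : induced_mod X :=
  tens (sub_group_ring L) (1 : trivZr G) x.

Definition induced_map (X Y : lmodType ZG) (f : {linear X -> Y}) :
    {linear induced_mod X -> induced_mod Y} :=
  @tmap _ (sub_group_ring L) (trivZr G) X Y f.

Lemma induced_map_tens (X Y : lmodType ZG) (f : {linear X -> Y}) m x :
  induced_map f (tens _ m x) = tens _ m (f x).
Proof. exact: tmap_tens. Qed.

Section Basis.
Variables (X : lmodType ZG) (B : based X).

(* The induced basis is indexed by itself, as a subset of induced_mod: distinct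
   pairs (g, b) may have the same image 1 (x) g b. *)
Definition induced_idx : choiceType :=
  set_type [set y : induced_mod X |
    exists (g : G) (b : bidx B), y = induced_elt (gr_elt g *: B b)].

Definition induced_vec (y : induced_idx) : induced_mod X := val y.

Lemma coordP (x : X) : x = lincomb B (coord B x).
Proof. by rewrite /coord; case: cid => c []. Qed.

Lemma coord_uniq (x : X) c : x = lincomb B c -> coord B x = c.
Proof. by move=> xc; rewrite /coord; case: cid => c' [] /= _; apply. Qed.

Lemma coord_is_linear : linear (coord B).
Proof.
by move=> a x y; apply: coord_uniq; rewrite linearP /= -!coordP.
Qed.

Section Functional.
Variables (g0 : G) (b0 : bidx B).

Let chi (h : G) : int^o := (h * g0^-1 \in L)%g%:R.
Let psi (a : ZG) : int := lincomb chi a.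

Let psiD a b : psi (a + b) = psi a + psi b.
Proof. by rewrite /psi raddfD. Qed.

Let psiU n h : psi << n *g h >> = n * chi h.
Proof. by rewrite /psi lincombU. Qed.

Let psi0 : psi 0 = 0. Proof. by rewrite /psi raddf0. Qed.

Let psiUM n k a : k \in L -> psi ((<< n *g k >> : ZG) * a) = n * psi a.
Proof.
move=> kL; elim/gr_ind: a => [|m x a IHa]; first by rewrite mulr0 psi0 mulr0.
rewrite mulrDr !psiD IHa mulrDr; congr (_ + _).
rewrite -[_ * _]/(gr_mul _ _) gr_mulUU !psiU mulrA /chi -mulgA.
by rewrite (gpredMl _ kL).
Qed.

Let psiM s a : s \in sub_group_ring L -> psi (s * a) = augmentation s * psi a.
Proof.
move=> /allP sL; rewrite {1}[s]monalgE /augmentation.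
rewrite !mulr_suml big_seq [RHS]big_seq.
rewrite (big_morph psi psiD psi0); apply: eq_bigr => k ks.
by rewrite psiUM //; apply: sL.
Qed.

Let t (m : trivZr G) (x : X) : int := (m : int) * psi (coord B x)@_b0.

Let tP : balanced (sub_group_ring L) t.
Proof.
split=> [m m' x|m x y|s m x sL].
- by rewrite /t mulrDl.
- by rewrite /t -[x]scale1r coord_is_linear mcoeffD mcoeffZ psiD mul1r scale1r mulrDr.
- rewrite /t -[s *: x]addr0 coord_is_linear mcoeffD mcoeffZ psiD psiM //.
  have -> : coord B 0 = 0 by apply: coord_uniq; rewrite raddf0.
  by rewrite mcoeff0 psi0 addr0 mulrCA mulrA.
Qed.

Lemma induced_functional : exists f : {additive induced_mod X -> int},
  forall g b, f (induced_elt (gr_elt g *: B b)) =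
    ((b == b0) && ((g * g0^-1)%g \in L))%:R.
Proof.
pose F : {additive _ -> _} :=
  HB.pack (tlift t : induced_mod X -> int)
    (GRing.isZmodMorphism.Build (induced_mod X) int _
       (tlift_is_zmod_morphism tP)).
exists F => g b; rewrite /F /= (tlift_tens tP) /t mul1r.
have -> : coord B (gr_elt g *: B b) = << gr_elt g *g b >>.
  by apply: coord_uniq; rewrite lincombU.
rewrite mcoeffU; case: eqP => _ /=; last by rewrite mulr0n psi0.
by rewrite mulr1n psiU mul1r.
Qed.

End Functional.

Lemma induced_elt_coset (l : G) (x : X) :
  l \in L -> induced_elt (gr_elt l *: x) = induced_elt x.
Proof.
move=> lL; rewrite /induced_elt -tensZ.
  congr tens; rewrite [LHS]/GRing.scale /= mulr1.
  exact: augmentationU.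
by apply/allP => k; rewrite /gr_elt msuppU /= inE => /eqP ->.
Qed.

Lemma induced_vec_spec (j : induced_idx) :
  exists (g : G) (b : bidx B), induced_vec j = induced_elt (gr_elt g *: B b).
Proof. exact: (set_mem (valP j)). Qed.

Lemma induced_vec_free (c : {malg int[induced_idx]}) :
  lincomb induced_vec c = 0 -> c = 0.
Proof.
move=> c0; apply/malgP => j0; rewrite mcoeff0.
have [g0 [b0 j0E]] := induced_vec_spec j0.
have [f fE] := induced_functional g0 b0.
have fj (j : induced_idx) : f (induced_vec j) = (j == j0)%:R.
  have [g [b jE]] := induced_vec_spec j; rewrite jE fE; congr (_%:R).
  congr (nat_of_bool _); apply/andP/eqP => [[/eqP bb0 gL]|jj0].
    apply: val_inj; rewrite /= -[LHS]/(induced_vec j) -[RHS]/(induced_vec j0).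
    rewrite jE j0E bb0 -[RHS](induced_elt_coset _ gL) scalerA; congr induced_elt.
    congr (_ *: _); rewrite -[_ * _]/(gr_mul _ _) gr_mulUU mulr1.
    by rewrite mulgVK.
  have : f (induced_vec j) = 1.
    by rewrite jj0 j0E fE eqxx mulgV gpred1.
  by rewrite jE fE; case: (b == b0); case: ((g / g0)%g \in L).
have := congr1 f c0; rewrite raddf0 /lincomb raddf_sum => <-.
rewrite (eq_bigr (fun j => c@_j *+ (j == j0))) => [|j _]; last first.
  rewrite raddfMz /= fj; case: eqP => _ /=; first by rewrite mulr1n intz.
  by rewrite mulr0n mul0rz.
have [jc|jc] := msuppP c j0.
  rewrite (big_fsetD1 j0) //= eqxx mulr1n big1_fset; first by rewrite addr0.
  by move=> j; rewrite in_fsetD1 => /andP[/negPf ->].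
rewrite big1_fset // => j jc' _; case: eqP => // jj0.
by rewrite jj0 (negPf jc) in jc'.
Qed.

Let tensMz (m : trivZr G) (x : X) (n : int) :
  tens (sub_group_ring L) m (x *~ n) = tens (sub_group_ring L) m x *~ n.
Proof.
pose h (u : X) := tens (sub_group_ring L) m u.
have hB : zmod_morphism h.
  by move=> u v; apply: (addIr (h v)); rewrite /h -[LHS]tensDr [RHS]subrK subrK.
pose H : {additive _ -> _} := HB.pack h (GRing.isZmodMorphism.Build _ _ h hB).
exact: (raddfMz H).
Qed.

Let tens0 (m : trivZr G) : tens (sub_group_ring L) m (0 : X) = 0.
Proof. by rewrite -[0 in LHS](mulr0z 0) tensMz mulr0z. Qed.

Let tensE (m : trivZr G) (x : X) :
  tens (sub_group_ring L) m x = induced_elt x *~ m.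
Proof.
pose h (k : trivZr G) := tens (sub_group_ring L) k x.
have hB : zmod_morphism h.
  by move=> u v; apply: (addIr (h v)); rewrite /h -[LHS]tensDl [RHS]subrK subrK.
pose H : {additive _ -> _} := HB.pack h (GRing.isZmodMorphism.Build _ _ h hB).
by rewrite -[m in LHS]intz; apply: (raddfMz H).
Qed.

Lemma induced_vecP : is_basis induced_vec.
Proof.
move=> y; suff [c yc] : exists c, y = lincomb induced_vec c.
  exists c; split=> // c' yc'; apply/eqP; rewrite -subr_eq0; apply/eqP.
  by apply: induced_vec_free; rewrite raddfB /= -yc -yc' subrr.
move: y; apply: tensor_span => [|x y [c ->] [c' ->]|m x].
- by exists 0; rewrite raddf0.
- by exists (c - c'); rewrite raddfB.
pose Q (u : X) := exists c, induced_elt u *~ m = lincomb induced_vec c.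
have Q0 : Q 0 by exists 0; rewrite raddf0 /induced_elt tens0 mul0rz.
have QD u v : Q u -> Q v -> Q (u + v).
  move=> [c uc] [d vd]; exists (c + d).
  by rewrite raddfD /= -uc -vd -mulrzDl /induced_elt tensDr.
rewrite tensE -/(Q x) (coordP x).
elim/malg_ind: (coord B x) => [|a b c IH]; first by rewrite raddf0.
rewrite raddfD /=.
apply: (QD); last exact: IH.
rewrite lincombU; clear c IH.
elim/gr_ind: a => [|n g a IHa]; first by rewrite scale0r; exact: Q0.
rewrite scalerDl.
apply: (QD); last exact: IHa.
clear IHa.
have jP : induced_elt (gr_elt g *: B b) \in [set y : induced_mod X |
    exists (g : G) (b : bidx B), y = induced_elt (gr_elt g *: B b)].
  by apply/mem_set; exists g, b.
exists << n * m *g (exist (fun y => y \in _) _ jP : induced_idx) >>; rewrite lincombU.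
have -> : (<< n *g g >> : ZG) = gr_elt g *~ n.
  by rewrite /gr_elt -raddfMz /= intz.
by rewrite -scalerMzl /induced_elt tensMz -mulrzA.
Qed.

Definition induced_based : based (induced_mod X) := Based induced_vecP.

End Basis.

End Induced.

Section InducedComplex.
Variables (G : groupType) (L : groupClosed G) (X : based_complex (group_ring G)).

Lemma induced_diffK (j : int) (x : induced_mod L (X (1 + (1 + j)))) :
  induced_map L (diff X j) (induced_map L (diff X (1 + j)) x) = 0.
Proof.
move: x; apply: tensor_span => [|x y hx hy|m x].
- by rewrite !raddf0.
- by rewrite raddfB /= raddfB /= hx hy subrr.
rewrite !induced_map_tens diffK.
by apply: (addIr (tens (sub_group_ring L) m (0 : X j))); rewrite -tensDr !add0r.
Qed.

Definition induced_complex : based_complex int :=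
  @BasedComplex int (ChainComplex induced_diffK)
    (fun j : int => induced_based L (bbase X j)).

End InducedComplex.

Section Quality.
Variable R : realType.

Definition l1norm (M : lmodType int) (B : based M) (x : M) : R :=
  \sum_(b <- msupp (coord B x)) `|((coord B x)@_b)%:~R|.

(* x = 0 contributes 0 / 0 = 0 to the supremum. *)
Definition opnorm (M N : lmodType int) (B : based M) (C : based N)
    (f : {linear M -> N}) : \bar R :=
  ereal_sup [set (l1norm C (f x) / l1norm B x)%:E | x in [set: M]].

(* Equal to 0 if the basis is infinite; only used in finitely generated degrees. *)
Definition rank (M : lmodType int) (B : based M) : nat :=
  #|` fset_set [set: bidx B] |%fset.

Definition quality_bound (T kappa : R) : \bar R :=
  (expR kappa * T `^ kappa)%:E.

Section Retract.
Variables (n : int) (X X' : based_complex int) (h : homotopy_retract X X').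
Variables (T kappa : R).

Definition is_domination : Prop :=
  [/\ forall j : int, j <= n -> finitely_generated (X j),
      forall j : int, j <= n -> finitely_generated (X' j) &
      forall j : int, j <= n ->
        (rank (bbase X' j))%:R <= kappa * T^-1 * (rank (bbase X j))%:R].

Definition is_weak_rebuilding : Prop :=
  [/\ is_domination,
      forall j : int, 1 + j <= n ->
        (opnorm (bbase X' (1 + j)) (bbase X' j) (diff X' j) <= quality_bound T kappa)%E &
      forall j : int, j <= n ->
        (opnorm (bbase X j) (bbase X' j) (hr_xi h j) <= quality_bound T kappa)%E].

Definition is_rebuilding : Prop :=
  [/\ is_weak_rebuilding,
      forall j : int, j <= n ->
        (opnorm (bbase X' j) (bbase X j) (hr_xi' h j) <= quality_bound T kappa)%E &
      forall j : int, j <= n ->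
        (opnorm (bbase X j) (bbase X (1 + j)) (hr_Xi h j) <= quality_bound T kappa)%E].

End Retract.

Definition admits_domination n (X : based_complex int) (T kappa : R) : Prop :=
  exists (X' : based_complex int) (_ : homotopy_retract X X'),
    is_domination n X X' T kappa.

Definition admits_weak_rebuilding n (X : based_complex int) (T kappa : R) : Prop :=
  exists (X' : based_complex int) (h : homotopy_retract X X'),
    is_weak_rebuilding n h T kappa.

Definition admits_rebuilding n (X : based_complex int) (T kappa : R) : Prop :=
  exists (X' : based_complex int) (h : homotopy_retract X X'),
    is_rebuilding n h T kappa.

End Quality.

Definition normal_subgroup (G : groupType) (L : groupClosed G) : Prop :=
  forall g l : G, l \in L -> (l ^ g)%g \in L.

Definition finite_index (G : groupType) (L : groupClosed G) : Prop :=
  finite_set [set [set (g * l)%g | l in [set l : G | l \in L]] | g in [set: G]].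

Definition residual_chain (G : groupType) (Ls : nat -> groupClosed G) : Prop :=
  [/\ forall g : G, g \in Ls 0%N,
      forall (i : nat) (g : G), g \in Ls i.+1 -> g \in Ls i,
      forall i : nat, normal_subgroup (Ls i) /\ finite_index (Ls i) &
      forall g : G, (forall i : nat, g \in Ls i) <-> g = 1%g].

Definition residually_finite (G : groupType) : Prop :=
  exists Ls : nat -> groupClosed G, residual_chain Ls.

Section Classes.
Variable R : realType.

Section ComplexClasses.
Variables (n : int) (G : groupType) (X : based_complex (group_ring G)).

Definition eventually_admits (Q : based_complex int -> R -> R -> Prop) : Prop :=
  (forall j : int, j <= n -> finitely_generated (X j)) /\
  exists kappa : R, 1 <= kappa /\
    forall T : R, 1 <= T ->
    forall Ls : nat -> groupClosed G, residual_chain Ls ->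
    exists i0 : nat, forall i : nat, (i0 <= i)%N ->
      Q (induced_complex (Ls i) X) T kappa.

Definition CR_complex : Prop := eventually_admits (admits_rebuilding n).
Definition CWR_complex : Prop := eventually_admits (admits_weak_rebuilding n).
Definition CD_complex : Prop := eventually_admits (admits_domination n).

End ComplexClasses.

Definition CR (n : int) (G : groupType) : Prop :=
  residually_finite G /\
  exists X : based_complex (group_ring G),
    projective_resolution (trivZ G) X /\ CR_complex n X.

Definition CWR (n : int) (G : groupType) : Prop :=
  residually_finite G /\
  exists X : based_complex (group_ring G),
    projective_resolution (trivZ G) X /\ CWR_complex n X.

Definition CD (n : int) (G : groupType) : Prop :=
  residually_finite G /\
  exists X : based_complex (group_ring G),
    projective_resolution (trivZ G) X /\ CD_complex n X.

End Classes.

(* Main.v *)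
Require Import Defs.
From HB Require Import structures.
From mathcomp Require Import all_boot all_order all_algebra finmap.
From mathcomp.multinomials Require Import monalg.
From mathcomp Require Import boolp classical_sets functions cardinality.
From mathcomp Require Import reals ereal sequences exp.

Set Implicit Arguments.
Unset Strict Implicit.
Unset Printing Implicit Defensive.

Import Order.TTheory GRing.Theory Num.Theory.

Local Open Scope classical_set_scope.
Local Open Scope ring_scope.

(** In degrees <= 0, a rebuilding only constrains X'_0, xi_0, xi'_0 and Xi_0.

    If G is finite, then the chain G, 1, 1, ... is residual, and for T large the
    rank of X'_0 is forced to be 0. Then every element of X_0 is a boundary,
    although the augmentation of X induces a functional that vanishes on
    boundaries but not on X_0.

    If G is infinite, take X_0 = ZG and let X_{n+1} be free on the kernel of the
    previous map, so that every g - 1 is the boundary of a basis element of X_1.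
    On X_Lambda this gives Xi : X_0 -> X_1 of norm at most 1 with
    d Xi = id - e1 eps, where e1 is the class of 1. Hence X_Lambda retracts onto
      ... -> X_2 -> X_1 -> Z,
    the last map being zero, via eps and e1 in degree 0 and via id and id - Xi d
    in degree 1. This complex has rank 1 in degree 0, whereas the index of
    Lambda_i tends to infinity, so kappa = 1 works. *)

(** * Coordinates and linear extension for based modules *)

Section Bases.
Variable R : nzRingType.

Lemma coordK (M : lmodType R) (B : based M) (x : M) :
  lincomb B (Defs.coord B x) = x.
Proof. by rewrite /Defs.coord; case: cid => c []. Qed.

Lemma lincombK (M : lmodType R) (B : based M) (c : {malg R[bidx B]}) :
  Defs.coord B (lincomb B c) = c.
Proof. by rewrite /Defs.coord; case: cid => c' [] /= _; apply. Qed.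

Lemma coord_linear (M : lmodType R) (B : based M) : linear (Defs.coord B).
Proof.
move=> a x y; rewrite -{1}(coordK B x) -{1}(coordK B y).
by rewrite -linearP lincombK.
Qed.

HB.instance Definition _ (M : lmodType R) (B : based M) :=
  GRing.isLinear.Build R M {malg R[bidx B]} _ (Defs.coord B) (coord_linear B).

Lemma coord_bvec (M : lmodType R) (B : based M) (b : bidx B) :
  Defs.coord B (B b) = << b >>.
Proof. by rewrite -[B b]scale1r -lincombU lincombK. Qed.

Lemma linear_lincomb (I : choiceType) (M N : lmodType R) (e : I -> M)
    (f : {linear M -> N}) (c : {malg R[I]}) :
  f (lincomb e c) = lincomb (f \o e) c.
Proof. by rewrite /lincomb linear_sum; apply: eq_bigr => i _; rewrite linearZ. Qed.

Lemma based_ext (M N : lmodType R) (B : based M) (f g : {linear M -> N}) :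
  (forall b, f (B b) = g (B b)) -> f =1 g.
Proof.
move=> fg x; rewrite -(coordK B x) !linear_lincomb.
by rewrite /lincomb; apply: eq_bigr => i _ /=; rewrite fg.
Qed.

Definition linext (M N : lmodType R) (B : based M) (e : bidx B -> N) (x : M) : N :=
  lincomb e (Defs.coord B x).

Lemma linext_linear (M N : lmodType R) (B : based M) (e : bidx B -> N) :
  linear (linext e).
Proof. by move=> a x y; rewrite /linext !linearP. Qed.

HB.instance Definition _ (M N : lmodType R) (B : based M) (e : bidx B -> N) :=
  GRing.isLinear.Build R M N _ (linext e) (linext_linear e).

Lemma linextE (M N : lmodType R) (B : based M) (e : bidx B -> N) b :
  linext e (B b) = e b.
Proof. by rewrite /linext coord_bvec lincombU scale1r. Qed.

Lemma cancel_is_basis (I : choiceType) (M : lmodType R) (e : I -> M)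
    (g : M -> {malg R[I]}) :
  cancel g (lincomb e) -> cancel (lincomb e) g -> is_basis e.
Proof. by move=> gK eK x; exists (g x); split=> // c ->; rewrite eK. Qed.

Lemma malgU_scale (I : choiceType) (a : R) (i : I) :
  a *: (<< i >> : {malg R[I]}) = << a *g i >>.
Proof. by apply/malgP => k; rewrite mcoeffZ !mcoeffU mulrnAr mulr1. Qed.

Lemma lincomb_malgU (I : choiceType) (c : {malg R[I]}) :
  lincomb (fun i => << i >>) c = c.
Proof.
rewrite [RHS]monalgE /lincomb; apply: eq_bigr => i _.
by rewrite malgU_scale.
Qed.

Lemma malg_is_basis (I : choiceType) :
  is_basis (fun i : I => << i >> : {malg R[I]}).
Proof. by apply: (cancel_is_basis (g := id)) => c; exact: lincomb_malgU. Qed.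

Definition malg_based (I : choiceType) : based {malg R[I]} :=
  Based (@malg_is_basis I).

End Bases.

(** * Complexes graded by the naturals, extended by zero to all integers *)

Section NatComplex.
Variables (R : nzRingType) (M : nat -> lmodType R) (B : forall n, based (M n)).
Variable d : forall n, {linear M n.+1 -> M n}.
Hypothesis dK : forall n (x : M n.+2), d n (d n.+1 x) = 0.

(** The zero module in negative degrees is taken free on [void], so that it is based like the
    others. *)
Definition nat_mod (j : int) : lmodType R :=
  match j with Posz n => M n | Negz _ => {malg R[void]} end.

Definition nat_based (j : int) : based (nat_mod j) :=
  match j with Posz n => B n | Negz _ => malg_based R void end.

(** The match on [j] lets [1 + Posz n] compute to [Posz n.+1], so [d n] has the required type
    without a cast. *)
Definition nat_diff (j : int) : {linear nat_mod (1 + j) -> nat_mod j} :=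
  match j return {linear nat_mod (1 + j) -> nat_mod j} with
  | Posz n => d n
  | Negz n => \0
  end.

Lemma nat_diffK j (x : nat_mod (1 + (1 + j))) : nat_diff j (nat_diff (1 + j) x) = 0.
Proof. by case: j x => n x //=; exact: dK. Qed.

Definition nat_complex : based_complex R :=
  @BasedComplex R (ChainComplex nat_diffK) nat_based.

Lemma nat_complex_neg (j : int) (x : nat_complex j) : j < 0 -> x = 0.
Proof. by case: j x => // n x _; apply/malgP => -[]. Qed.

End NatComplex.

(** * The homotopy retract with degree 0 replaced by a module of rank one *)

Section Retract.
Variable X : based_complex int.
Hypothesis Xneg : forall (j : int) (x : X j), j < 0 -> x = 0.
Variables (eps : {linear X 0 -> {malg int[unit]}}) (e1 : X 0).
Variable Xi : {linear X 0 -> X (1 + 0)}.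
Hypothesis eps_diff : forall x, eps (diff X 0 x) = 0.

Definition const_map : {malg int[unit]} -> X 0 := linext (B := malg_based int unit) (fun=> e1).
Hypothesis diff_Xi : forall x, diff X 0 (Xi x) = x - const_map (eps x).

Definition retract_mod (n : nat) : lmodType int :=
  if n is n'.+1 then X (Posz n'.+1) else {malg int[unit]}.

Definition retract_based (n : nat) : based (retract_mod n) :=
  match n return based (retract_mod n) with
  | 0 => malg_based int unit
  | n'.+1 => bbase X (Posz n'.+1)
  end.

Definition retract_diff (n : nat) : {linear retract_mod n.+1 -> retract_mod n} :=
  match n return {linear retract_mod n.+1 -> retract_mod n} with
  | 0 => \0
  | n'.+1 => diff X (Posz n'.+1)
  end.

Lemma retract_diffK n (x : retract_mod n.+2) : retract_diff n (retract_diff n.+1 x) = 0.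
Proof.
by case: n x => [//|n] x; exact: (diffK (c := X) (j := Posz n.+1) x).
Qed.

Definition retract : based_complex int := nat_complex retract_based retract_diffK.

Definition retract_xi (j : int) : {linear X j -> retract j} :=
  match j return {linear X j -> retract j} with
  | Posz n =>
      match n return {linear X (Posz n) -> retract_mod n} with
      | 0 => eps
      | n'.+1 => idfun
      end
  | Negz _ => \0
  end.

Definition retract_xi' (j : int) : {linear retract j -> X j} :=
  match j return {linear retract j -> X j} with
  | Posz n =>
      match n return {linear retract_mod n -> X (Posz n)} with
      | 0 => const_map
      | 1 => idfun \- (Xi \o diff X 0)
      | n'.+2 => idfun
      end
  | Negz _ => \0
  end.

Definition retract_Xi (j : int) : {linear X j -> X (1 + j)} :=
  match j return {linear X j -> X (1 + j)} with
  | Posz n =>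
      match n return {linear X (Posz n) -> X (1 + Posz n)} with
      | 0 => Xi
      | _ => \0
      end
  | Negz _ => \0
  end.

Lemma retract_xiP j (x : X (1 + j)) :
  retract_xi j (diff X j x) = diff retract j (retract_xi (1 + j) x).
Proof.
by case: j x => [[|n]|n] x //=; exact: eps_diff.
Qed.

Lemma const0 : const_map 0 = 0.
Proof. by rewrite /const_map raddf0. Qed.

(** Since [eps] kills boundaries, d Xi d = d, so id - Xi d takes values in cycles. This makes
    [retract_xi'] compatible with the zero differential from degree 1 to degree 0. *)
Lemma diff_proj (x : X (1 + 0)) : diff X 0 (x - Xi (diff X 0 x)) = 0.
Proof. by rewrite raddfB /= diff_Xi eps_diff const0 (subr0 (diff X 0 x)) subrr. Qed.

Lemma retract_xi'P j (x : retract (1 + j)) :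
  retract_xi' j (diff retract j x) = diff X j (retract_xi' (1 + j) x).
Proof.
case: j x => [[|[|n]]|[|n]] x //=.
- by rewrite [linext _ _]const0; exact/esym/diff_proj.
(* On boundaries from degree 2 the correction Xi d is zero because d d = 0. *)
- have dx : diff X 0 (diff X (Posz 1) x) = 0 by apply: diffK.
  by rewrite [X in Xi X]dx raddf0 (subr0 (diff X (Posz 1) x)).
- by rewrite [RHS]Xneg.
- by rewrite raddf0.
Qed.

(** The identity lives in degree [1 + j]. For [j = Posz 0] it is the definition of [retract_xi'] in
    degree 1; for [j = Negz 0] it is [diff_Xi] in degree 0. In all other degrees both sides
    vanish. *)
Lemma retract_htpy j (x : X (1 + j)) :
  diff X (1 + j) (retract_Xi (1 + j) x) + retract_Xi j (diff X j x)
  = x - retract_xi' (1 + j) (retract_xi (1 + j) x).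
Proof.
have f0D (M N : lmodType int) (f : {linear M -> N}) b c : b = c -> f 0 + b = c.
  by rewrite raddf0 add0r.
case: j x => [[|[|n]]|[|n]] x /=.
- by apply: f0D; rewrite subKr.
- by apply: f0D; rewrite subrr.
- by apply: f0D; rewrite subrr.
- by rewrite addr0 [LHS]diff_Xi.
- by rewrite [LHS]Xneg ?[RHS]Xneg.
Qed.

Definition retractP : homotopy_retract X retract :=
  @HomotopyRetract _ X retract (ChainMap retract_xiP) (ChainMap retract_xi'P)
    retract_Xi retract_htpy.

End Retract.

(** * The l1-norm and operator norms *)

Section Norm.
Variable R : realType.

Section OneModule.
Variables (M : lmodType int) (B : based M).

(** Enlarging the index set lets the norms of several vectors be compared over one common finite
    set. *)
Lemma l1normw (x : M) (d : {fset bidx B}) : (msupp (Defs.coord B x) `<=` d)%fset ->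
  l1norm R B x = \sum_(b <- d) `|((Defs.coord B x)@_b)%:~R|.
Proof.
move=> led; apply: big_fset_incl => // b _ /mcoeff_outdom ->.
by rewrite mulr0z normr0.
Qed.

Lemma l1norm_ge0 x : 0 <= l1norm R B x.
Proof. by apply: sumr_ge0. Qed.

Lemma l1norm0 : l1norm R B 0 = 0.
Proof. by rewrite /l1norm raddf0 msupp0 big_seq_fset0. Qed.

Lemma l1normD x y : l1norm R B (x + y) <= l1norm R B x + l1norm R B y.
Proof.
pose d := (msupp (Defs.coord B x) `|` msupp (Defs.coord B y))%fset.
rewrite (l1normw (d := d)) ?raddfD ?msuppD_le //=.
rewrite (l1normw (x := x) (d := d)) ?fsubsetUl //.
rewrite (l1normw (x := y) (d := d)) ?fsubsetUr // -big_split /=.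
by apply: ler_sum => b _; rewrite mcoeffD intrD ler_normD.
Qed.

Lemma l1normZ (a : int) x : l1norm R B (a *: x) = `|a%:~R| * l1norm R B x.
Proof.
rewrite (l1normw (d := msupp (Defs.coord B x))) ?linearZ ?msuppZ_le //=.
rewrite mulr_sumr; apply: eq_bigr => b _.
by rewrite mcoeffZ intrM normrM.
Qed.

Lemma l1norm_bvec b : l1norm R B (B b) = 1.
Proof.
rewrite /l1norm coord_bvec msuppU oner_eq0 big_seq_fset1 mcoeffUU.
by rewrite normr1.
Qed.

End OneModule.

Section Operator.
Variables (M N : lmodType int) (B : based M) (C : based N) (f : {linear M -> N}).

(** The triangle inequality, applied to the expansion of [x] in [B], reduces an operator bound to
    basis vectors. *)
Lemma l1norm_le (c : R) x : (forall b, l1norm R C (f (B b)) <= c) ->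
  l1norm R C (f x) <= c * l1norm R B x.
Proof.
move=> fc; rewrite -{1}(coordK B x) linear_lincomb /lincomb.
rewrite [X in _ <= c * X]/l1norm mulr_sumr.
apply: (big_ind2 (fun y r => l1norm R C y <= r)) => [|u r v s ur vs|b _].
- by rewrite l1norm0.
- by apply: le_trans (l1normD _ _ _) _; apply: lerD.
- by rewrite l1normZ mulrC; apply: ler_wpM2r => //; exact: fc.
Qed.

Lemma opnorm_le (c : R) : 0 <= c -> (forall b, l1norm R C (f (B b)) <= c) ->
  (opnorm R B C f <= c%:E)%E.
Proof.
move=> c0 fc; apply: ge_ereal_sup => _ [x _ <-]; rewrite lee_fin.
(* Vectors of norm 0 contribute 0 / 0 = 0 to the supremum. *)
have [x0|xN0] := eqVneq (l1norm R B x) 0; first by rewrite x0 invr0 mulr0.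
by rewrite ler_pdivrMr ?l1norm_le// lt_neqAle eq_sym xN0 l1norm_ge0.
Qed.

(** Both factors of [quality_bound] are at least 1, so maps of norm at most 1 meet the bound for all
    admissible [T] and [k]. *)
Lemma opnorm_quality (T k : R) : 1 <= T -> 1 <= k ->
  (forall b, l1norm R C (f (B b)) <= 1) ->
  (opnorm R B C f <= quality_bound T k)%E.
Proof.
move=> T1 k1 f1; apply: le_trans (opnorm_le ler01 f1) _.
rewrite lee_fin -[1]mulr1; apply: ler_pM => //.
  by rewrite -expR0 ler_expR (le_trans _ k1).
by rewrite -(powRr0 T) ler_powR// (le_trans _ k1).
Qed.

Lemma opnorm_triv (T k : R) : (forall y : N, y = 0) ->
  (opnorm R B C f <= quality_bound T k)%E.
Proof.
move=> N0; apply: ge_ereal_sup => _ [x _ <-]; rewrite lee_fin.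
by rewrite (N0 (f x)) l1norm0 mul0r mulr_ge0 ?expR_ge0 ?powR_ge0.
Qed.

End Operator.
End Norm.

(** * Finite generation and rank *)

Section Rank.

Lemma based_finitely_generated (A : nzRingType) (M : lmodType A) (B : based M) :
  finite_set [set: bidx B] -> finitely_generated M.
Proof.
move=> fB; pose e : seq (bidx B) := fset_set [set: bidx B].
exists [seq B b | b <- e] => x.
exists (fun i => nth 0 [seq (Defs.coord B x)@_b | b <- e] i).
rewrite -{1}(coordK B x) (@lincombw _ _ _ B (Defs.coord B x) (fset_set [set: bidx B])); last first.
  by apply/fsubsetP => b _; rewrite in_fset_set// mem_setT.
rewrite -/e; elim: e => [|b e IH]; first by rewrite big_nil big_ord0.
by rewrite big_cons IH big_ord_recl.
Qed.

(** Each basis vector is a combination of the generators, so its index lies in the union of their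
    finite supports. *)
Lemma finitely_generated_based (A : nzRingType) (M : lmodType A) (B : based M) :
  finitely_generated M -> finite_set [set: bidx B].
Proof.
move=> [s sP].
pose d := (\bigcup_(x <- s) msupp (Defs.coord B x))%fset.
apply: (sub_finite_set _ (finite_fset d)) => b _ /=.
have [c bE] := sP (B b).
have : b \in msupp (Defs.coord B (B b)) by rewrite coord_bvec msuppU oner_eq0 inE.
apply: contraLR => bd; rewrite bE linear_sum /= -mcoeff_eq0.
rewrite raddf_sum /= big1 // => i _; rewrite linearZ /= mcoeffZ.
rewrite (mcoeff_outdom (g := Defs.coord B _)) ?mulr0 //.
apply: contra bd => bs; apply/bigfcupP; exists s`_i; rewrite ?mem_nth //.
Qed.

(** Finite generation rules out the default value 0 of [rank] on an infinite basis, so the basis is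
    really empty. *)
Lemma rank_eq0 (M : lmodType int) (B : based M) :
  finitely_generated M -> rank B = 0%N -> forall x : M, x = 0.
Proof.
move=> /finitely_generated_based fB /eqP; rewrite /rank cardfs_eq0 => /eqP /fset_set_set0 B0 x.
rewrite -(coordK B x) /lincomb big1 // => b _.
have : [set: bidx B] b by []. by rewrite B0.
Qed.

Lemma card_le_rank (M : lmodType int) (B : based M) (d : {fset bidx B}) :
  finite_set [set: bidx B] -> (#|` d| <= rank B)%N.
Proof.
move=> fB; apply: fsubset_leq_card; apply/fsubsetP => b _.
by rewrite in_fset_set// mem_setT.
Qed.

Lemma rank_malg_unit : rank (malg_based int unit) = 1%N.
Proof.
rewrite /rank /= (_ : [set: unit] = [set tt]) ?fset_set1 ?cardfs1 //.
by apply/seteqP; split => -[].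
Qed.

Lemma rank_triv (M : lmodType int) (B : based M) : (forall x : M, x = 0) ->
  rank B = 0%N.
Proof.
move=> M0; rewrite /rank (_ : [set: bidx B] = set0) ?fset_set0 ?cardfs0 //.
apply/seteqP; split => b // _.
have := coord_bvec b; rewrite (M0 (B b)) raddf0 => /esym/eqP.
by rewrite monalgU_eq0 oner_eq0.
Qed.

End Rank.

(** The retract has rank 1 in degree 0, so the rank condition there reads 1 <= kappa T^-1 rank X_0,
    which is the last hypothesis. All maps to be bounded have norm at most 1 or a zero target. *)
Lemma retract_rebuilding (R : realType) (X : based_complex int)
    (Xneg : forall (j : int) (x : X j), j < 0 -> x = 0)
    (eps : {linear X 0 -> {malg int[unit]}}) (e1 : X 0)
    (Xi : {linear X 0 -> X (1 + 0)})
    (eps_diff : forall x, eps (diff X 0 x) = 0)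
    (diff_Xi : forall x, diff X 0 (Xi x) = x - const_map e1 (eps x))
    (T kappa : R) :
  1 <= T -> 1 <= kappa ->
  finitely_generated (X 0) ->
  (forall b, l1norm R (malg_based int unit) (eps (bbase X 0 b)) <= 1) ->
  l1norm R (bbase X 0) e1 <= 1 ->
  (forall b, l1norm R (bbase X (1 + 0)) (Xi (bbase X 0 b)) <= 1) ->
  T <= kappa * (rank (bbase X 0))%:R ->
  is_rebuilding 0 (retractP Xneg eps_diff diff_Xi) T kappa.
Proof.
move=> T1 k1 fg epsB e1B XiB TR.
have fg0 (M : lmodType int) : (forall x : M, x = 0) -> finitely_generated M.
  by move=> M0; exists [::] => x; exists (fun=> 0); rewrite big_ord0; exact: M0.
have kp : 0 < kappa by apply: lt_le_trans k1.
have Tp : 0 < T by apply: lt_le_trans T1.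
split; first split; first split.
- case=> [[|//]|n] _ //.
  by apply: fg0 => x; exact: Xneg.
- case=> [[|//]|n] _ /=.
    apply: (based_finitely_generated (B := malg_based int unit)).
    exact: finite_finset.
  by apply: fg0 => x; apply/malgP => -[].
- case=> [[|//]|n] _ /=.
    rewrite rank_malg_unit mulrAC ler_pdivlMr ?mul1r //.
  rewrite rank_triv; last by move=> x; apply/malgP => -[].
  apply: mulr_ge0; last exact: ler0n.
  by apply: divr_ge0; exact: ltW.
(* A differential starting in degree at most 0 ends in a negative degree, where the module is
   zero. *)
- case=> [//|n] _; apply: opnorm_triv => y; exact: (nat_complex_neg y).
- case=> [[|//]|n] _ /=; first exact: opnorm_quality.
  by apply: opnorm_triv => y; apply/malgP => -[].
- case=> [[|//]|n] _ /=; last by apply: opnorm_triv => y; exact: Xneg.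
  by apply: opnorm_quality => // -[] /=; rewrite linextE.
- case=> [[|//]|n] _ /=; first exact: opnorm_quality.
  apply: opnorm_quality => // b; rewrite l1norm0 //.
Qed.

(** * Free resolutions by iterated covers of kernels *)

Section FreeResolution.
Variable A : nzRingType.

Lemma based_projective (P : lmodType A) (B : based P) : projective P.
Proof.
move=> M N f g fsurj.
have [e eP] := choice (fun b => fsurj (g (B b))).
exists (linext e) => x.
apply: (based_ext (B := B) (f := f \o linext e)) => b /=.
by rewrite linextE.
Qed.

(** The index type is bundled with the map because each stage of the recursion is indexed by the
    kernel of the previous one. *)
Record free_map := FreeMap {
  fm_idx : choiceType;
  fm_cod : lmodType A;
  fm_map :> {linear {malg A[fm_idx]} -> fm_cod} }.

(** Every kernel element, not just a generating family, becomes a basis index. Exactness is then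
    immediate, and any chosen cycle is the boundary of a single basis vector. *)
Definition cover_idx (f : free_map) : choiceType :=
  {x : {malg A[fm_idx f]} | f x == 0}.

Definition cover (f : free_map) : free_map :=
  FreeMap (lincomb (val : cover_idx f -> {malg A[fm_idx f]})).

Lemma coverK (f : free_map) x : f (cover f x) = 0.
Proof.
rewrite /= linear_lincomb /lincomb big1 // => k _ /=.
by rewrite (eqP (valP k)) scaler0.
Qed.

Definition coverU (f : free_map) x (fx : f x == 0) : {malg A[fm_idx (cover f)]} :=
  << exist (fun x => f x == 0) x fx >>.

Lemma cover_coverU (f : free_map) x (fx : f x == 0) : cover f (coverU fx) = x.
Proof. by rewrite /= lincombU scale1r. Qed.

Variable f0 : free_map.

(** [res_map n] is the map out of degree [n]: [res_map 0] is the augmentation, and [res_map n.+1] is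
    the differential [res_diff n]. *)
Fixpoint res_map (n : nat) : free_map :=
  if n is n'.+1 then cover (res_map n') else f0.

Definition res_mod (n : nat) : lmodType A := {malg A[fm_idx (res_map n)]}.

Definition res_based (n : nat) : based (res_mod n) := malg_based A (fm_idx (res_map n)).

Definition res_diff (n : nat) : {linear res_mod n.+1 -> res_mod n} := cover (res_map n).

Lemma res_diffK n (x : res_mod n.+2) : res_diff n (res_diff n.+1 x) = 0.
Proof. exact: (coverK (f := res_map n.+1) x). Qed.

Definition resolution : based_complex A := nat_complex res_based res_diffK.

Lemma resolutionP : (forall m, exists x, f0 x = m) ->
  projective_resolution (fm_cod f0) resolution.
Proof.
move=> f0surj; split.
- by case=> n; [exact: (based_projective (res_based n)) |
                exact: (based_projective (malg_based A void))].
- exact: nat_complex_neg.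
- case=> // n x _ /= /eqP dx0.
  by exists (coverU (f := res_map n.+1) dx0); rewrite [RHS]cover_coverU.
- exists f0; split=> // x; split=> [/eqP fx0|[y ->]]; last exact: (coverK (f := f0) y).
  by exists (coverU fx0); rewrite [RHS]cover_coverU.
Qed.

End FreeResolution.

(** * Augmentation, finiteness and rank of induced modules *)

Section Induced.
Variables (G : groupType) (L : groupClosed G).
Local Notation ZG := (group_ring G).
Local Notation tens_ := (tens (sub_group_ring L)).

Lemma tens0 (X : lmodType ZG) (m : trivZr G) : tens_ m (0 : X) = 0.
Proof. by apply: (addIr (tens_ m (0 : X))); rewrite -tensDr !add0r. Qed.

Lemma induced_eltB (X : lmodType ZG) (x y : X) :
  induced_elt L (x - y) = induced_elt L x - induced_elt L y.
Proof.
by apply: (addIr (induced_elt L y)); rewrite /induced_elt -[LHS]tensDr !subrK.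
Qed.

Lemma induced_triv (X : lmodType ZG) : (forall x : X, x = 0) ->
  forall z : induced_mod L X, z = 0.
Proof.
move=> X0; apply: tensor_span => [//|x y -> ->|m x]; first by rewrite subr0.
by rewrite (X0 x) tens0.
Qed.

Section Augmentation.
Variables (X : lmodType ZG) (aug : {linear X -> trivZ G}).

Let t (m : trivZr G) (x : X) : {malg int[unit]} := << (m : int) * (aug x : int) *g tt >>.

Let tP : balanced (sub_group_ring L) t.
Proof.
split=> [m m' x|m x y|s m x sL].
- by rewrite /t -monalgUD -mulrDl.
- by rewrite /t raddfD -monalgUD -mulrDr.
- rewrite /t linearZ; congr (<< _ *g _ >>).
  by rewrite [LHS]mulrAC mulrC mulrA mulrAC.
Qed.

(** The formula is balanced because the group ring acts on both trivial modules through its own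
    augmentation. The values lie in the free module on [unit], to match degree 0 of the retract. *)
Lemma induced_augmentation : exists eps : {linear induced_mod L X -> {malg int[unit]}},
  forall m x, eps (tens_ m x) = << (m : int) * (aug x : int) *g tt >>.
Proof.
pose F : {additive _ -> _} :=
  HB.pack (tlift t : induced_mod L X -> {malg int[unit]})
    (GRing.isZmodMorphism.Build (induced_mod L X) {malg int[unit]} _
       (tlift_is_zmod_morphism tP)).
have Fl : linear F.
  move=> a x y; rewrite raddfD; congr (_ + _).
  by rewrite -[a]intz !scaler_int raddfMz.
pose F' : {linear _ -> _} := HB.pack (F : induced_mod L X -> {malg int[unit]})
    (GRing.isLinear.Build int (induced_mod L X) {malg int[unit]} _ F Fl).
by exists F' => m x; exact: (tlift_tens tP).
Qed.

End Augmentation.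

Lemma augmentation_induced_map (X Y : lmodType ZG) (f : {linear Y -> X})
    (aug : {linear X -> trivZ G}) (eps : {linear induced_mod L X -> {malg int[unit]}}) :
  (forall m x, eps (tens_ m x) = << (m : int) * (aug x : int) *g tt >>) ->
  (forall y, aug (f y) = 0) -> forall y, eps (induced_map L f y) = 0.
Proof.
move=> epsE fK; pose c : {linear _ -> _} := eps \o induced_map L f.
apply: (tensor_span (P := fun y => c y = 0)) => [|u v hu hv|m x].
- exact: raddf0.
- by apply: (eq_trans (y := c u - c v)); [exact: (raddfB c) | rewrite hu hv subrr].
- apply: (eq_trans (congr1 eps (induced_map_tens L f m x))).
  by rewrite epsE fK mulr0; exact: monalgU0.
Qed.

Lemma mem_induced_basis (X : lmodType ZG) (B : based X) g b :
  exists k : bidx (induced_based L B),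
    induced_based L B k = induced_elt L (gr_elt g *: B b).
Proof.
have kP : induced_elt L (gr_elt g *: B b) \in [set y : induced_mod L X |
    exists (g : G) (b : bidx B), y = induced_elt L (gr_elt g *: B b)].
  by apply/mem_set; exists g, b.
by exists (exist (fun y => y \in _) _ kP : induced_idx L B).
Qed.

(** The image of g b depends only on the coset g L and on b, so finitely many cosets and finitely
    many b give finitely many images. *)
Lemma induced_basis_finite (X : lmodType ZG) (B : based X) :
  normal_subgroup L -> finite_index L -> finite_set [set: bidx B] ->
  finite_set [set: bidx (induced_based L B)].
Proof.
move=> nL fL fB.
(* [xget] picks a representative of the coset; its default is never reached on a coset, which is
   nonempty. *)
pose F (p : set G * bidx B) := induced_elt L (gr_elt (xget 1%g p.1) *: B p.2).
have /finite_preimage := finite_image F (finite_setX fL fB).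
move=> /(_ _ (val : induced_idx L B -> _))
  /(_ (fun k l _ _ => @val_inj _ _ _ k l)); apply: sub_finite_set => k _ /=.
have [g [b kE]] := induced_vec_spec k.
exists ([set (g * l)%g | l in [set l : G | l \in L]], b) => /=.
  by split=> //; exists g.
rewrite -[RHS]/(induced_vec k) kE /F /=; case: xgetP => [x _ [l lL <-]|/(_ g) []]; last first.
  by exists 1%g; rewrite /= ?gpred1 ?mulg1.
(* The index is counted with cosets g L, whereas the tensor product absorbs factors of L on the
   left. Normality passes between the two, by g l = (g l g^-1) g. *)
have <- : gr_elt (l ^ g^-1)%g * gr_elt g = gr_elt (g * l)%g.
  by rewrite -[_ * _]/(gr_mul _ _) gr_mulUU mulr1 /conjg invgK mulgA mulgVK.
by rewrite -scalerA induced_elt_coset//; exact: nL.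
Qed.

(** The coset functional of h at [b0] is 1 on the class of h b0 and 0 on that of g b0 when g h^-1 is
    outside L, so distinct elements of [d] give distinct basis vectors. *)
Lemma induced_rank_ge (X : lmodType ZG) (B : based X) (b0 : bidx B) (d : {fset G}) :
  finite_set [set: bidx (induced_based L B)] ->
  {in d &, forall g h : G, g != h -> (g * h^-1)%g \notin L} ->
  (#|` d| <= rank (induced_based L B))%N.
Proof.
move=> fI dL; have [k kE] := choice (fun g => mem_induced_basis g b0).
suff <- : #|` [fset k g | g in d]%fset| = #|` d| by exact: card_le_rank.
apply: card_in_imfset => g h gd hd /= kgh; apply/eqP/negP => /negP /(dL _ _ gd hd).
have [f fE] := induced_functional L h b0.
have := fE g b0; rewrite -kE kgh kE fE eqxx mulgV gpred1 /=.
by case: (_ \in L).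
Qed.

End Induced.

(** * Separation of finite sets by residual chains *)

Lemma residual_chain_anti (G : groupType) (Ls : nat -> groupClosed G) i j :
  residual_chain Ls -> (i <= j)%N -> {subset Ls j <= Ls i}.
Proof.
move=> [_ LS _ _] /subnK <- g; elim: (j - i)%N => [//|k IH].
by rewrite addSn => /LS /IH.
Qed.

(** The trivial intersection separates each pair at some stage, and nestedness preserves this. The
    maximum of these stages over the finitely many pairs works for all of [d]. *)
Lemma residual_chain_separates (G : groupType) (Ls : nat -> groupClosed G)
    (d : {fset G}) : residual_chain Ls ->
  exists i0, forall i, (i0 <= i)%N ->
    {in d &, forall g h : G, g != h -> (g * h^-1)%g \notin Ls i}.
Proof.
move=> Lsc; have [_ _ _ Lcap] := Lsc.
have sep (p : G * G) : exists k, p.1 != p.2 -> (p.1 * p.2^-1)%g \notin Ls k.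
  have [->|pN] := eqVneq p.1 p.2; first by exists 0%N.
  apply: contrapT => /forallNP nk; move/negP: pN; apply; apply/eqP.
  apply/(mulIg p.2^-1)%g; rewrite mulgV; apply/Lcap => k.
  by apply: contrapT => /negP kN; apply: (nk k).
have [k kP] := choice sep.
exists (\max_(g <- d) \max_(h <- d) k (g, h))%N => i ki g h gd hd gh.
apply: contra (kP (g, h) gh); apply: residual_chain_anti => //.
apply: leq_trans ki; apply: leq_trans (leq_bigmax_seq _ gd isT).
exact: (leq_bigmax_seq _ hd isT).
Qed.

(** * Rebuilding an induced complex whose degree 0 has one generator *)

Section Rebuilding.
Variables (R : realType) (G : groupType) (L : groupClosed G).
Variable X : based_complex (group_ring G).
Hypothesis Xneg : forall (j : int) (x : X j), j < 0 -> x = 0.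
Variable aug : {linear X 0 -> trivZ G}.
Hypothesis aug_diff : forall x, aug (diff X 0 x) = 0.
Variable b0 : bidx (bbase X 0).
Hypothesis b0P : forall b, b = b0.
Hypothesis aug_b0 : aug (bbase X 0 b0) = 1.
Hypothesis edge : forall g : G, exists k : bidx (bbase X (1 + 0)),
  diff X 0 (bbase X (1 + 0) k) = gr_elt g *: bbase X 0 b0 - bbase X 0 b0.

(** The boundary of the class of the edge for g is the class of g b0 minus [e1]. Hence [Xi] can send
    basis vectors to basis vectors, and d Xi = id - e1 eps holds on the basis because [eps] sends
    each basis vector to the generator. *)
Lemma induced_rebuilding (T kappa : R) : normal_subgroup L -> finite_index L ->
  1 <= T -> 1 <= kappa ->
  T <= kappa * (rank (bbase (induced_complex L X) 0))%:R ->
  admits_rebuilding 0 (induced_complex L X) T kappa.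
Proof.
move=> nL fL T1 k1 TR.
set Y := induced_complex L X.
have Yneg (j : int) (y : Y j) : j < 0 -> y = 0.
  by move=> j0; apply: induced_triv => x; exact: Xneg.
have [eps epsE] := induced_augmentation L aug.
pose e1 : Y 0 := induced_elt L (bbase X 0 b0).
have [k1e k1E] := mem_induced_basis L 1%g b0.
(* As the class of 1 b0, [e1] is itself an induced basis vector, so its norm is 1. *)
have {}k1E : bbase Y 0 k1e = e1 by rewrite k1E [_ *: _]scale1r.
have aug_g g b : aug (gr_elt g *: bbase X 0 b) = 1.
  by rewrite linearZ (b0P b) aug_b0 [LHS]mulr1; exact: augmentationU.
have eps_elt x : eps (induced_elt L x) = << (aug x : int) *g tt >>.
  by rewrite epsE mul1r.
have eps_diff (y : Y (1 + 0)) : eps (diff Y 0 y) = 0 :=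
  augmentation_induced_map epsE aug_diff y.
have eps_b (y : bidx (bbase Y 0)) : eps (bbase Y 0 y) = << tt >>.
  have [g [b yE]] := induced_vec_spec y.
  by rewrite [bbase Y 0 y]yE eps_elt aug_g.
have XiP (y : bidx (bbase Y 0)) : exists z : Y (1 + 0),
    diff Y 0 z = bbase Y 0 y - e1 /\ l1norm R (bbase Y (1 + 0)) z <= 1.
  have [g [b yE]] := induced_vec_spec y.
  have [k kE] := edge g; have [l lE] := mem_induced_basis L 1%g k.
  exists (bbase Y (1 + 0) l); split; last by rewrite l1norm_bvec.
  rewrite lE [_ *: _]scale1r [LHS]induced_map_tens kE [LHS]induced_eltB.
  by rewrite [bbase Y 0 y]yE (b0P b).
have [e eP] := choice XiP.
pose Xi : {linear Y 0 -> Y (1 + 0)} := linext e.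
have Xi_b y : Xi (bbase Y 0 y) = e y by rewrite /Xi /= linextE.
have diff_Xi x : diff Y 0 (Xi x) = x - const_map e1 (eps x).
  apply: (based_ext (B := bbase Y 0) (f := diff Y 0 \o Xi)
    (g := idfun \- (linext (B := malg_based int unit) (fun=> e1) \o eps))) => y.
  rewrite /= -/(Xi (bbase Y 0 y)) Xi_b eps_b; have [-> _] := eP y.
  by rewrite (linextE (B := malg_based int unit) (fun=> e1) tt).
have Yf : finite_set [set: bidx (bbase Y 0)].
  apply: induced_basis_finite => //.
  rewrite (_ : [set: _] = [set b0]) ?finite_set1//.
  by apply/seteqP; split=> // b _; exact: b0P.
eexists; exists (retractP Yneg eps_diff diff_Xi).
apply: retract_rebuilding => //.
- exact: based_finitely_generated Yf.
- move=> y; rewrite eps_b.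
  by rewrite (l1norm_bvec R (B := malg_based int unit) tt).
- by rewrite -k1E l1norm_bvec.
- by move=> y; rewrite Xi_b; have [] := eP y.
Qed.

End Rebuilding.

(** * Inclusions obtained by forgetting norm bounds *)

Lemma CR_CWR (R : realType) n (G : groupType) : CR R n G -> CWR R n G.
Proof.
move=> [rG [X [pX [fX [k [k1 kP]]]]]]; split=> //; exists X; do 2!split=> //.
exists k; split=> // T T1 Ls rLs; have [i0 i0P] := kP T T1 Ls rLs.
by exists i0 => i /i0P[X' [h []]]; exists X', h.
Qed.

Lemma CWR_CD (R : realType) n (G : groupType) : CWR R n G -> CD R n G.
Proof.
move=> [rG [X [pX [fX [k [k1 kP]]]]]]; split=> //; exists X; do 2!split=> //.
exists k; split=> // T T1 Ls rLs; have [i0 i0P] := kP T T1 Ls rLs.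
by exists i0 => i /i0P[X' [h []]]; exists X', h.
Qed.

(** * Infinite residually finite groups lie in [CR] for n = 0 *)

Section GroupResolution.
Variable G : groupType.
Local Notation ZG := (group_ring G).

Definition aug_map : free_map ZG :=
  FreeMap (lincomb (fun _ : unit => 1 : trivZ G)).

Lemma aug_map_surj m : exists x, aug_map x = m.
Proof.
exists << << m *g 1%g >> *g tt >>; rewrite [LHS]lincombU.
by rewrite -[RHS]mulr1 -[in RHS](augmentationU m (1%g : G)).
Qed.

Lemma infinite_CR (R : realType) : residually_finite G ->
  infinite_set [set: G] -> CR R 0 G.
Proof.
move=> rG iG; split=> //; exists (resolution aug_map); split.
  exact: (resolutionP aug_map_surj).
split.
  case=> [[|//]|n] _.
    apply: (based_finitely_generated (B := malg_based ZG unit)).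
    exact: finite_finset.
  apply: (based_finitely_generated (B := malg_based ZG void)).
  exact: finite_finset.
exists 1; split=> // T T1 Ls rLs.
(* More than [T] elements are chosen; once [Ls i] separates them, the rank in degree 0 is at least
   their number. *)
have [d _ dN] := infinite_set_fset (Num.truncn T).+1 iG.
have [i0 i0P] := residual_chain_separates d rLs.
exists i0 => i /i0P sep; have [_ _ /(_ i) [nL fL] _] := rLs.
apply: (@induced_rebuilding R G (Ls i) (resolution aug_map) _ (fm_map aug_map) _ tt) => //.
- exact: nat_complex_neg.
- exact: (coverK (f := aug_map)).
- by case.
- by rewrite [LHS]lincombU scale1r.
- move=> g.
  have e0 : aug_map (gr_elt g *: << tt >> - << tt >>) == 0.
    apply/eqP; apply: (eq_trans (raddfB aug_map _ _)).
    rewrite malgU_scale; apply/eqP; rewrite subr_eq0; apply/eqP.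
    apply: (eq_trans (lincombU _ _ _)); apply: (eq_trans _ (esym (lincombU _ _ _))).
    rewrite scale1r [LHS]mulr1; exact: augmentationU.
  exists (exist (fun x => aug_map x == 0) _ e0).
  exact: (cover_coverU e0).
rewrite mul1r.
have fI : finite_set [set: bidx (bbase (induced_complex (Ls i) (resolution aug_map)) 0)].
  by apply: induced_basis_finite => //; exact: finite_finset.
have := induced_rank_ge (tt : bidx (bbase (resolution aug_map) 0)) fI sep.
move=> /(leq_trans dN) rk; apply: ltW; apply: lt_le_trans (truncnS_gt T) _.
by rewrite ler_nat.
Qed.

End GroupResolution.

(** * Finite groups are excluded from [CD] for n = 0 *)

Section FiniteGroup.
Variable G : groupType.

Definition full_pred : {pred G} := fun=> true.
Definition triv_pred : {pred G} := fun g => g == 1%g.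

Let full_inv : invg_closed full_pred. Proof. by []. Qed.
Let full1 : (1 : G)%g \in full_pred. Proof. by []. Qed.
Let full_mul : mulg_closed full_pred. Proof. by []. Qed.

Definition full_group : groupClosed G := HB.pack full_pred
  (isInvClosed.Build G full_pred full_inv) (isMul1Closed.Build G full_pred full1)
  (isMulClosed.Build G full_pred full_mul).

Let triv_inv : invg_closed triv_pred.
Proof. by move=> x; rewrite !unfold_in => /eqP->; rewrite invg1. Qed.

Let triv1 : (1 : G)%g \in triv_pred.
Proof. by rewrite unfold_in. Qed.

Let triv_mul : mulg_closed triv_pred.
Proof. by move=> x y; rewrite !unfold_in => /eqP-> /eqP->; rewrite mulg1. Qed.

Definition triv_group : groupClosed G := HB.pack triv_pred
  (isInvClosed.Build G triv_pred triv_inv) (isMul1Closed.Build G triv_pred triv1)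
  (isMulClosed.Build G triv_pred triv_mul).

Definition finite_chain (i : nat) : groupClosed G :=
  if i is _.+1 then triv_group else full_group.

Lemma finite_chainP : finite_set [set: G] -> residual_chain finite_chain.
Proof.
move=> fG; split=> //.
- by case.
- move=> i; split; last first.
    pose c (g : G) := [set (g * l)%g | l in [set l : G | l \in finite_chain i]].
    apply: (sub_finite_set _ (finite_image c fG)).
    by move=> _ [g _ <-]; exists g.
  case: i => [//|i] g l; rewrite /= !unfold_in => /eqP ->.
  by rewrite conj1g.
move=> g; split=> [/(_ 1%N)|-> [|i]]; rewrite ?unfold_in//=; first by move/eqP.
Qed.

End FiniteGroup.

(** If X'_0 were zero, the homotopy identity would make every degree-0 element a boundary. The class
    [z] of an element of augmentation 1 is not one, since [eps] vanishes on boundaries. *)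
Lemma domination_rank_gt0 (G : groupType) (L : groupClosed G)
    (X : based_complex (group_ring G)) (X' : based_complex int) :
  projective_resolution (trivZ G) X -> homotopy_retract (induced_complex L X) X' ->
  finitely_generated (X' 0) -> (0 < rank (bbase X' 0))%N.
Proof.
move=> [_ Xneg _ [aug [augS augE]]] h fX'; rewrite lt0n; apply/eqP => r0.
have X'0 := rank_eq0 fX' r0.
have [eps epsE] := induced_augmentation L aug.
have [x augx] := augS 1.
pose Y := induced_complex L X.
pose z : Y 0 := induced_elt L x.
have dz : diff Y (-1) z = 0 by apply: induced_triv => y; exact: Xneg.
have Xidz : hr_Xi h (-1) (diff Y (-1) z) = 0 by rewrite dz raddf0.
have xi'z : hr_xi' h 0 (hr_xi h 0 z) = 0 by rewrite (X'0 (hr_xi h 0 z)) raddf0.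
(* The identity in degree 0 is the instance at [-1], as [1 + -1] computes to 0. *)
have : diff Y 0 (hr_Xi h 0 z) + hr_Xi h (-1) (diff Y (-1) z)
    = z - hr_xi' h 0 (hr_xi h 0 z) := @hr_htpyP _ _ _ h (-1) z.
rewrite Xidz xi'z (addr0 (diff Y 0 _)) (subr0 z) => zE.
have : eps z = 0.
  by rewrite -zE; apply: (augmentation_induced_map epsE) => y; apply/augE; exists y.
rewrite epsE augx mulr1 => /eqP; rewrite monalgU_eq0 //.
Qed.

Lemma CD_infinite (R : realType) (G : groupType) : CD R 0 G -> infinite_set [set: G].
Proof.
move=> [_ [X [pX [_ [k [k1 kP]]]]]] fG.
pose r := rank (bbase (induced_complex (triv_group G) X) 0).
(* With this [T], the rank bound k r / T is below 1, which forces the rank of X'_0 to be 0. *)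
pose T : R := 1 + k * r%:R.
have T1 : 1 <= T by rewrite lerDl mulr_ge0// (le_trans ler01 k1).
(* A successor index is used so that the term of [finite_chain] is the trivial group, for which [r]
   was computed. *)
have [i0 /(_ i0.+1 (leqnSn _)) [X' [h [_ fX' rX']]]] := kP T T1 _ (finite_chainP fG).
have := domination_rank_gt0 pX h (fX' 0 (lexx 0)).
apply/negP; rewrite -leqNgt leqn0 -leqn0 -ltnS -(ltr_nat R).
apply: le_lt_trans (rX' 0 (lexx 0)) _.
rewrite mulrAC ltr_pdivrMr ?(lt_le_trans ltr01)// mul1r.
by rewrite /T ltrDr.
Qed.

Theorem lemma5p10 (R : realType) (G : groupType) :
  [/\ CR R 0 G <-> CWR R 0 G,
      CWR R 0 G <-> CD R 0 G &
      CD R 0 G <-> residually_finite G /\ infinite_set [set: G]].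
Proof.
have CDi : CD R 0 G -> residually_finite G /\ infinite_set [set: G].
  by move=> cd; split; [case: cd | exact: CD_infinite cd].
have iCR : residually_finite G /\ infinite_set [set: G] -> CR R 0 G.
  by move=> [rG iG]; exact: infinite_CR.
split; split.
- exact: CR_CWR.
- by move=> /CWR_CD/CDi/iCR.
- exact: CWR_CD.
- by move=> /CDi/iCR/CR_CWR.
- exact: CDi.
- by move=> /iCR/CR_CWR/CWR_CD.
Qed.
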